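(* Let $K$ be a field of characteristic $0$, $A_1=A_1(K)$ the first Weyl algebra, and $\mathcal{B}=\{\mathbf{p}^i\mathbf{q}^j : i,j\in\mathbb{Z}_{\ge 0}\}$. (1) The degree maps on $A_1$ over $K$ for which $\mathcal{B}$ is an evaluation basis are exactly the maps $\mathsf{v}_{\rho,\sigma}$ with $(\rho,\sigma)\in\mathbb{R}^2$ and $\rho+\sigma\ge 0$. (2) Two degree maps $\mathsf{v}_{\rho_1,\sigma_1}$ and $\mathsf{v}_{\rho_2,\sigma_2}$ on $A_1$ (with $\rho_i+\sigma_i\ge 0$) are equivalent if and only if there exists $r\in\mathbb{R}_{>0}$ with $(\rho_2,\sigma_2)=r(\rho_1,\sigma_1)$. (3) $\mathsf{v}_{\rho,\sigma}$ is the trivial degree map on $A_1$ if and only if $(\rho,\sigma)=(0,0)$. For $\rho+\sigma\ge 0$ and $(\rho,\sigma)\neq(0,0)$, the degree map $\mathsf{v}_{\rho,\sigma}$ is discrete if and only if $\rho,\sigma$ are linearly dependent over $\mathbb{Q}$; in this case, up to equivalence, one can choose $(\rho,\sigma)$ to be coprime integers.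
   Context: $A_1(K)$ is the unital associative $K$-algebra generated by $\mathbf{p},\mathbf{q}$ with the relation $\mathbf{q}\mathbf{p}-\mathbf{p}\mathbf{q}=1$; $\mathcal{B}$ is a $K$-basis of it, and $D_1(K)$ is its quotient division ring. A degree map on a ring $R$ is a map $u:R\to\mathbb{R}\cup\{-\infty\}$ with $u(fg)=u(f)+u(g)$, $u(f+g)\le\max\{u(f),u(g)\}$ for all $f,g\in R$, and $u(f)=-\infty$ iff $f=0$. It is trivial if $u(R\setminus\{0\})=\{0\}$. A degree map on a $K$-algebra is over $K$ if its restriction to $K$ is trivial. Two degree maps $u_1,u_2$ on $R$ are equivalent if there is $c\in\mathbb{R}_{>0}$ with $u_2(f)=c\,u_1(f)$ for all nonzero $f\in R$. Every degree map $u$ on $A_1$ extends uniquely to a degree map on $D_1(K)$ by $u(zw^{-1})=u(z)-u(w)$; a degree map on $A_1$ is called discrete if its extension to $D_1(K)$ has value group $u(D_1(K)\setminus\{0\})\cong\mathbb{Z}$. A $K$-basis $\{y_i\}_{i\in I}$ of a $K$-algebra $A$ is an evaluation basis for a degree map $u$ on $A$ over $K$ if $u(\sum_i\lambda_iy_i)=\sup\{u(y_i):\lambda_i\ne 0\}$ for every nonzero $\sum_i\lambda_iy_i$ ($\lambda_i\in K$). For $(\rho,\sigma)\in\mathbb{R}^2$, $\mathsf{v}_{\rho,\sigma}:A_1\to\mathbb{R}\cup\{-\infty\}$ is defined by $\mathsf{v}_{\rho,\sigma}(0)=-\infty$ and $\mathsf{v}_{\rho,\sigma}(\sum\lambda_{i,j}\mathbf{p}^i\mathbf{q}^j)=\sup\{\rho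 i+\sigma j:\lambda_{i,j}\neq 0\}$ for a nonzero element. *)

(* Defs.v *)
From HB Require Import structures.
From mathcomp Require Import all_boot all_order all_algebra.
From mathcomp Require Import finmap.
From mathcomp Require Import all_classical all_reals ereal.

Set Implicit Arguments.
Unset Strict Implicit.
Unset Printing Implicit Defensive.

Import Order.TTheory GRing.Theory Num.Theory.
Local Open Scope classical_set_scope.
Local Open Scope ring_scope.
Local Open Scope quotient_scope.

(* The Weyl algebra is given by its presentation: formal expressions in the
   generators, modulo the smallest congruence that contains the axioms of
   unital associative K-algebras and the relation q p - p q = 1. *)

Inductive weyl_term (K : Type) : Type :=
| WP
| WQ
| WConst of K
| WAdd of weyl_term K & weyl_term K
| WOpp of weyl_term K
| WMul of weyl_term K & weyl_term K.
Arguments WP {K}.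
Arguments WQ {K}.

HB.instance Definition _ (K : Type) := gen_eqMixin (weyl_term K).
HB.instance Definition _ (K : Type) := gen_choiceMixin (weyl_term K).

Inductive weyl_cong (K : fieldType) : weyl_term K -> weyl_term K -> Prop :=
| wc_refl a : weyl_cong a a
| wc_sym a b : weyl_cong a b -> weyl_cong b a
| wc_trans b a c : weyl_cong a b -> weyl_cong b c -> weyl_cong a c
| wc_add a a' b b' : weyl_cong a a' -> weyl_cong b b' ->
    weyl_cong (WAdd a b) (WAdd a' b')
| wc_opp a a' : weyl_cong a a' -> weyl_cong (WOpp a) (WOpp a')
| wc_mul a a' b b' : weyl_cong a a' -> weyl_cong b b' ->
    weyl_cong (WMul a b) (WMul a' b')
| wc_addA a b c : weyl_cong (WAdd a (WAdd b c)) (WAdd (WAdd a b) c)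
| wc_addC a b : weyl_cong (WAdd a b) (WAdd b a)
| wc_add0 a : weyl_cong (WAdd (WConst 0) a) a
| wc_addN a : weyl_cong (WAdd (WOpp a) a) (WConst 0)
| wc_mulA a b c : weyl_cong (WMul a (WMul b c)) (WMul (WMul a b) c)
| wc_mul1l a : weyl_cong (WMul (WConst 1) a) a
| wc_mul1r a : weyl_cong (WMul a (WConst 1)) a
| wc_mulDl a b c :
    weyl_cong (WMul (WAdd a b) c) (WAdd (WMul a c) (WMul b c))
| wc_mulDr a b c :
    weyl_cong (WMul a (WAdd b c)) (WAdd (WMul a b) (WMul a c))
| wc_constD x y : weyl_cong (WConst (x + y)) (WAdd (WConst x) (WConst y))
| wc_constM x y : weyl_cong (WConst (x * y)) (WMul (WConst x) (WConst y))
| wc_constC x a : weyl_cong (WMul (WConst x) a) (WMul a (WConst x))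
| wc_rel : weyl_cong (WAdd (WMul WQ WP) (WOpp (WMul WP WQ))) (WConst 1).

Definition weyl_eq (K : fieldType) : rel (weyl_term K) :=
  fun a b => `[< weyl_cong a b >].

Section WeylAlgebra.
Variable K : fieldType.
Local Notation T := (weyl_term K).

Lemma weyl_eq_refl : reflexive (@weyl_eq K).
Proof. by move=> a; apply/asboolP/wc_refl. Qed.
Lemma weyl_eq_sym : symmetric (@weyl_eq K).
Proof.
by move=> a b; apply/idP/idP => /asboolP h; apply/asboolP/wc_sym.
Qed.
Lemma weyl_eq_trans : transitive (@weyl_eq K).
Proof.
by move=> b a c /asboolP h1 /asboolP h2; apply/asboolP/(wc_trans h1 h2).
Qed.

Definition weyl_equiv : equiv_rel T :=
  EquivRel (@weyl_eq K) weyl_eq_refl weyl_eq_sym weyl_eq_trans.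

Definition weyl : Type := {eq_quot weyl_equiv}.
HB.instance Definition _ := Choice.on weyl.

Definition wpi (a : T) : weyl := \pi_{eq_quot weyl_equiv} a.
Definition wrepr (x : weyl) : T := repr (x : {eq_quot weyl_equiv}).

Lemma wreprK x : wpi (wrepr x) = x.
Proof. exact: reprK. Qed.

Lemma wpiP (a b : T) : wpi a = wpi b <-> weyl_cong a b.
Proof.
split; first by move=> /eqmodP /asboolP.
by move=> h; apply/eqmodP/asboolP.
Qed.

Lemma wrepr_pi a : weyl_cong (wrepr (wpi a)) a.
Proof. by apply/wpiP; rewrite wreprK. Qed.

Definition weyl_add (x y : weyl) : weyl := wpi (WAdd (wrepr x) (wrepr y)).
Definition weyl_opp (x : weyl) : weyl := wpi (WOpp (wrepr x)).
Definition weyl_mul (x y : weyl) : weyl := wpi (WMul (wrepr x) (wrepr y)).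
Definition weyl_scale (c : K) (x : weyl) : weyl :=
  wpi (WMul (WConst c) (wrepr x)).

Lemma wpi_add a b : weyl_add (wpi a) (wpi b) = wpi (WAdd a b).
Proof. by apply/wpiP; apply: wc_add; apply: wrepr_pi. Qed.
Lemma wpi_opp a : weyl_opp (wpi a) = wpi (WOpp a).
Proof. by apply/wpiP; apply: wc_opp; apply: wrepr_pi. Qed.
Lemma wpi_mul a b : weyl_mul (wpi a) (wpi b) = wpi (WMul a b).
Proof. by apply/wpiP; apply: wc_mul; apply: wrepr_pi. Qed.
Lemma wpi_scale c a : weyl_scale c (wpi a) = wpi (WMul (WConst c) a).
Proof.
by apply/wpiP; apply: wc_mul; [exact: wc_refl|exact: wrepr_pi].
Qed.

Let wpiE := (wpi_add, wpi_opp, wpi_mul, wpi_scale).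

Lemma weylW (P : weyl -> Prop) : (forall a, P (wpi a)) -> forall x, P x.
Proof. by move=> h x; rewrite -(wreprK x). Qed.

Lemma weyl_addA : associative weyl_add.
Proof.
elim/weylW=> a; elim/weylW=> b; elim/weylW=> c; rewrite !wpiE.
exact/wpiP/wc_addA.
Qed.
Lemma weyl_addC : commutative weyl_add.
Proof.
by elim/weylW=> a; elim/weylW=> b; rewrite !wpiE; apply/wpiP/wc_addC.
Qed.
Lemma weyl_add0 : left_id (wpi (WConst 0)) weyl_add.
Proof. by elim/weylW=> a; rewrite !wpiE; apply/wpiP/wc_add0. Qed.
Lemma weyl_addN : left_inverse (wpi (WConst 0)) weyl_opp weyl_add.
Proof. by elim/weylW=> a; rewrite !wpiE; apply/wpiP/wc_addN. Qed.

HB.instance Definition _ :=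
  GRing.isZmodule.Build weyl weyl_addA weyl_addC weyl_add0 weyl_addN.

Lemma weyl_mulA : associative weyl_mul.
Proof.
elim/weylW=> a; elim/weylW=> b; elim/weylW=> c; rewrite !wpiE.
exact/wpiP/wc_mulA.
Qed.
Lemma weyl_mul1l : left_id (wpi (WConst 1)) weyl_mul.
Proof. by elim/weylW=> a; rewrite !wpiE; apply/wpiP/wc_mul1l. Qed.
Lemma weyl_mul1r : right_id (wpi (WConst 1)) weyl_mul.
Proof. by elim/weylW=> a; rewrite !wpiE; apply/wpiP/wc_mul1r. Qed.
Lemma weyl_mulDl : left_distributive weyl_mul +%R.
Proof.
elim/weylW=> a; elim/weylW=> b; elim/weylW=> c.
rewrite /GRing.add /= !wpiE; exact/wpiP/wc_mulDl.
Qed.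
Lemma weyl_mulDr : right_distributive weyl_mul +%R.
Proof.
elim/weylW=> a; elim/weylW=> b; elim/weylW=> c.
rewrite /GRing.add /= !wpiE; exact/wpiP/wc_mulDr.
Qed.

(* The action on K[X], with p acting as multiplication by X and q as d/dX. *)
Fixpoint weyl_act (a : T) (f : {poly K}) : {poly K} :=
  match a with
  | WP => 'X * f
  | WQ => f^`()
  | WConst c => c *: f
  | WAdd a b => weyl_act a f + weyl_act b f
  | WOpp a => - weyl_act a f
  | WMul a b => weyl_act a (weyl_act b f)
  end.

Lemma weyl_act_linear a c f g :
  weyl_act a (c *: f + g) = c *: weyl_act a f + weyl_act a g.
Proof.
elim: a f g => [|||a IHa b IHb|a IHa|a IHa b IHb] /= => [f g|f g|x f g|f g|f g|f g].
- by rewrite mulrDr scalerAr.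
- by rewrite derivD derivZ.
- by rewrite scalerDr !scalerA mulrC.
- by rewrite IHa IHb scalerDr addrACA.
- by rewrite IHa opprD scalerN.
- by rewrite IHb IHa.
Qed.

Lemma weyl_actD a f g : weyl_act a (f + g) = weyl_act a f + weyl_act a g.
Proof. by have := weyl_act_linear a 1 f g; rewrite !scale1r. Qed.

Lemma weyl_act0 a : weyl_act a 0 = 0.
Proof.
by apply: (@addIr _ (weyl_act a 0)); rewrite -weyl_actD !add0r.
Qed.

Lemma weyl_actZ a c f : weyl_act a (c *: f) = c *: weyl_act a f.
Proof. by have := weyl_act_linear a c f 0; rewrite weyl_act0 !addr0. Qed.

Lemma weyl_act_cong a b : weyl_cong a b -> weyl_act a =1 weyl_act b.
Proof.
elim=> {a b} /=.
- by [].
- by move=> a b _ IH f; rewrite IH.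
- by move=> b a c _ IH1 _ IH2 f; rewrite IH1 IH2.
- by move=> a a' b b' _ IH1 _ IH2 f; rewrite IH1 IH2.
- by move=> a a' _ IH f; rewrite IH.
- by move=> a a' b b' _ IH1 _ IH2 f; rewrite IH2 IH1.
- by move=> a b c f; rewrite addrA.
- by move=> a b f; rewrite addrC.
- by move=> a f; rewrite scale0r add0r.
- by move=> a f; rewrite scale0r addNr.
- by [].
- by move=> a f; rewrite scale1r.
- by move=> a f; rewrite scale1r.
- by [].
- by move=> a b c f; rewrite weyl_actD.
- by move=> x y f; rewrite scalerDl.
- by move=> x y f; rewrite scalerA.
- by move=> x a f; rewrite weyl_actZ.
- by move=> f; rewrite derivM derivX mul1r addrK scale1r.
Qed.

Lemma weyl_oner_neq0 : wpi (WConst 1) != 0.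
Proof.
apply/eqP=> /wpiP /weyl_act_cong /(_ 1) /=.
by move/eqP; rewrite scale1r scale0r oner_eq0.
Qed.

HB.instance Definition _ := GRing.Zmodule_isNzRing.Build weyl
  weyl_mulA weyl_mul1l weyl_mul1r weyl_mulDl weyl_mulDr weyl_oner_neq0.

Lemma weyl_scalerA (a b : K) (v : weyl) :
  weyl_scale a (weyl_scale b v) = weyl_scale (a * b) v.
Proof.
elim/weylW: v => v; rewrite !wpiE; apply/wpiP.
apply: wc_trans (wc_mulA _ _ _) _.
by apply: wc_mul; [apply/wc_sym/wc_constM|apply: wc_refl].
Qed.
Lemma weyl_scale1r : left_id 1 weyl_scale.
Proof. by elim/weylW=> a; rewrite !wpiE; apply/wpiP/wc_mul1l. Qed.
Lemma weyl_scalerDr : right_distributive weyl_scale +%R.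
Proof.
move=> c; elim/weylW=> a; elim/weylW=> b.
rewrite /GRing.add /= !wpiE; exact/wpiP/wc_mulDr.
Qed.
Lemma weyl_scalerDl (v : weyl) :
  {morph weyl_scale^~ v : a b / a + b >-> a + b}.
Proof.
move=> a b; elim/weylW: v => v; rewrite {2}/GRing.add /= !wpiE; apply/wpiP.
apply: wc_trans (wc_mulDl _ _ _).
by apply: wc_mul; [apply: wc_constD|apply: wc_refl].
Qed.

HB.instance Definition _ := GRing.Zmodule_isLmodule.Build K weyl
  weyl_scalerA weyl_scale1r weyl_scalerDr weyl_scalerDl.

Lemma weyl_scalerAl (c : K) (u v : weyl) : c *: (u * v) = (c *: u) * v.
Proof.
elim/weylW: u => a; elim/weylW: v => b.
rewrite /GRing.scale /GRing.mul /= !wpiE; exact/wpiP/wc_mulA.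
Qed.

HB.instance Definition _ :=
  GRing.Lmodule_isLalgebra.Build K weyl weyl_scalerAl.

Lemma weyl_scalerAr (c : K) (u v : weyl) : c *: (u * v) = u * (c *: v).
Proof.
elim/weylW: u => a; elim/weylW: v => b.
rewrite /GRing.scale /GRing.mul /= !wpiE; apply/wpiP.
apply: wc_trans (wc_mulA _ _ _) _.
apply: wc_trans (wc_sym (wc_mulA _ _ _)).
by apply: wc_mul; [apply: wc_constC|apply: wc_refl].
Qed.

HB.instance Definition _ :=
  GRing.Lalgebra_isAlgebra.Build K weyl weyl_scalerAr.

Definition weyl_p : weyl := wpi WP.
Definition weyl_q : weyl := wpi WQ.

Lemma weyl_rel : weyl_q * weyl_p - weyl_p * weyl_q = 1.
Proof.
have -> : weyl_q * weyl_p - weyl_p * weyl_q =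
  weyl_add (weyl_mul weyl_q weyl_p) (weyl_opp (weyl_mul weyl_p weyl_q)) by [].
by rewrite /weyl_q /weyl_p !wpiE; apply/wpiP; apply: wc_rel.
Qed.

End WeylAlgebra.

Definition lincomb (K : fieldType) (A : algType K) (I : choiceType)
    (y : I -> A) (l : {fsfun I -> K with 0}) : A :=
  \sum_(i <- finsupp l) l i *: y i.

Definition is_basis (K : fieldType) (A : algType K) (I : choiceType)
    (y : I -> A) : Prop :=
  forall f : A, exists! l : {fsfun I -> K with 0}, f = lincomb y l.

Definition weyl_monomial (K : fieldType) (ij : nat * nat) : weyl K :=
  weyl_p K ^+ ij.1 * weyl_q K ^+ ij.2.

Section MonomialBasis.
Variable K : fieldType.
Local Notation y := (@weyl_monomial K).
Local Notation W := (weyl K).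

Lemma weyl_ind (P : W -> Prop) :
  P (weyl_p K) -> P (weyl_q K) -> (forall c : K, P c%:A) ->
  (forall a b, P a -> P b -> P (a + b)) ->
  (forall a, P a -> P (- a)) ->
  (forall a b, P a -> P b -> P (a * b)) -> forall x, P x.
Proof.
move=> hp hq hc hD hN hM; elim/weylW; elim=> //.
- move=> c; have := hc c; rewrite [_%:A]wpi_scale.
  by rewrite (iffRL (wpiP _ _) (wc_mul1r (WConst c))).
- by move=> a ha b hb; rewrite -wpi_add; apply: hD.
- by move=> a ha; rewrite -wpi_opp; apply: hN.
- by move=> a ha b hb; rewrite -wpi_mul; apply: hM.
Qed.

Definition wact (x : W) (f : {poly K}) := weyl_act (wrepr x) f.

Lemma wact_pi a f : wact (wpi a) f = weyl_act a f.
Proof. exact/weyl_act_cong/wrepr_pi. Qed.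

Lemma wactD x z f : wact (x + z) f = wact x f + wact z f.
Proof. by rewrite [x + z]/(weyl_add x z) wact_pi. Qed.

Lemma wactM x z f : wact (x * z) f = wact x (wact z f).
Proof. by rewrite [x * z]/(weyl_mul x z) wact_pi. Qed.

Lemma wactZ c x f : wact (c *: x) f = c *: wact x f.
Proof. by rewrite [c *: x]/(weyl_scale c x) wact_pi. Qed.

Lemma wact0 f : wact 0 f = 0.
Proof. by rewrite [0]/(wpi (WConst 0)) wact_pi /= scale0r. Qed.

Lemma wact1 f : wact 1 f = f.
Proof. by rewrite [1]/(wpi (WConst 1)) wact_pi /= scale1r. Qed.

Lemma wact_p i f : wact (weyl_p K ^+ i) f = 'X^i * f.
Proof.
elim: i => [|i IH]; first by rewrite !expr0 wact1 mul1r.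
by rewrite !exprS wactM IH wact_pi /= mulrA.
Qed.

Lemma wact_q j f : wact (weyl_q K ^+ j) f = f^`(j).
Proof.
elim: j => [|j IH]; first by rewrite expr0 wact1.
by rewrite exprS wactM IH wact_pi /=.
Qed.

Lemma lincomb_wider (S : {fset nat * nat}) (l : {fsfun nat * nat -> K with 0}) :
  (finsupp l `<=` S)%fset -> lincomb y l = \sum_(x <- S) l x *: y x.
Proof.
move=> sub; apply: big_fset_incl => // x _ xl.
by rewrite fsfun_dflt // scale0r.
Qed.

Lemma wact_sum (S : seq (nat * nat)) (F : nat * nat -> W) f :
  wact (\sum_(x <- S) F x) f = \sum_(x <- S) wact (F x) f.
Proof.
elim: S => [|a S IH]; first by rewrite !big_nil wact0.
by rewrite !big_cons wactD IH.
Qed.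

Lemma weyl_monomial_inj (l1 l2 : {fsfun nat * nat -> K with 0}) :
  [pchar K] =i pred0 -> lincomb y l1 = lincomb y l2 -> l1 = l2.
Proof.
move=> charK e; apply/fsfunP => -[m n].
elim/ltn_ind: n m => n IH m.
set S := (finsupp l1 `|` finsupp l2)%fset.
have e0 : \sum_(x <- S) (l1 x - l2 x) *: y x = 0.
  under eq_bigr do rewrite scalerBl.
  by rewrite sumrB -!lincomb_wider ?fsubsetUl ?fsubsetUr // e subrr.
have [mS|mS] := boolP ((m, n) \in S); last first.
  by move: mS; rewrite in_fsetU negb_or => /andP[h1 h2]; rewrite !fsfun_dflt.
have := congr1 (fun x => (wact x 'X^n)`_m) e0.
rewrite wact0 coef0 wact_sum coef_sum (big_fsetD1 (m, n)) //=.
rewrite big1_fset ?addr0; last first.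
  move=> [i j]; rewrite in_fsetD1 => /andP[ne _] _.
  rewrite wactZ wactM wact_p wact_q /= derivnXn mulrnAr -exprD coefZ coefMn.
  rewrite coefXn; case: (ltngtP j n) => jn.
  - by rewrite IH // subrr mul0r.
  - by rewrite ffact_small // mulr0n mulr0.
  rewrite jn subnn addn0; case: eqP => [mi|_]; last by rewrite mul0rn mulr0.
  by rewrite jn mi eqxx in ne.
rewrite wactZ wactM wact_p wact_q /= derivnXn mulrnAr -exprD coefZ coefMn.
rewrite subnn addn0 coefXn eqxx ffactnn => /eqP; rewrite mulf_eq0 subr_eq0.
case/orP => [/eqP //|].
by rewrite (iffLR (pcharf0P K) charK) eqn0Ngt fact_gt0.
Qed.

Let span (f : W) := exists l, f = lincomb y l.

Let spanD f g : span f -> span g -> span (f + g).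
Proof.
move=> [l1 ->] [l2 ->]; set S := (finsupp l1 `|` finsupp l2)%fset.
exists [fsfun x in S => l1 x + l2 x | 0].
rewrite (@lincomb_wider S l1) ?fsubsetUl // (@lincomb_wider S l2) ?fsubsetUr //.
rewrite (@lincomb_wider S) ?finsupp_sub // -big_split /=.
by apply: eq_big_seq => x xS; rewrite fsfunE xS scalerDl.
Qed.

Let spanZ c f : span f -> span (c *: f).
Proof.
move=> [l ->]; pose l' := [fsfun x in finsupp l => c * l x | 0 : K].
exists l'; rewrite (@lincomb_wider (finsupp l) l') ?finsupp_sub //.
rewrite /lincomb scaler_sumr.
by apply: eq_big_seq => x xS; rewrite fsfunE xS scalerA.
Qed.

Let span0 : span 0.
Proof. by exists [fsfun]; rewrite /lincomb finsupp0 big_seq_fset0. Qed.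

Let span_y x : span (y x).
Proof.
exists [fsfun z in [fset x]%fset => 1 | 0].
rewrite (@lincomb_wider [fset x]%fset) ?finsupp_sub //.
by rewrite big_seq_fset1 fsfunE in_fset1 eqxx scale1r.
Qed.

Let span_lin (h : W -> W) f : (forall a b, h (a + b) = h a + h b) ->
  (forall c a, h (c *: a) = c *: h a) -> h 0 = 0 ->
  (forall x, span (h (y x))) -> span f -> span (h f).
Proof.
move=> hD hZ h0 hy [l ->]; rewrite /lincomb.
elim: (enum_fset (finsupp l)) => [|x s IH]; first by rewrite big_nil h0.
by rewrite big_cons hD hZ; apply: spanD => //; apply: spanZ.
Qed.

Lemma weyl_q_p_exp i :
  weyl_q K * weyl_p K ^+ i =
  weyl_p K ^+ i * weyl_q K + i%:R *: weyl_p K ^+ i.-1.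
Proof.
have e : weyl_q K * weyl_p K = weyl_p K * weyl_q K + 1.
  by rewrite -(weyl_rel K) addrC subrK.
elim: i => [|i IH]; first by rewrite expr0 mulr1 mul1r scale0r addr0.
rewrite exprS mulrA e mulrDl mul1r -mulrA IH mulrDr !mulrA -addrA.
congr (_ + _); rewrite /= -scalerAr; case: i {IH} => [|i].
  by rewrite scale0r add0r scale1r.
by rewrite /= -exprS -[X in _ + X]scale1r -scalerDl -[in RHS]natr1.
Qed.

Lemma weyl_monomial_span f : exists l, f = lincomb y l.
Proof.
rewrite -[f]mulr1; have : span 1.
  by rewrite -[1]mulr1; apply: (span_y (0, 0)%N).
move: (1 : W); elim/weyl_ind: f => [g|g|c g|a b IHa IHb g|a IHa g|a b IHa IHb g] hg.
- apply: span_lin (hg) => [a b|c a||[i j]]; rewrite ?mulrDr ?scalerAr ?mulr0 //.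
  by rewrite /weyl_monomial mulrA -exprS; apply: (span_y (i.+1, j)).
- apply: span_lin (hg) => [a b|c a||[i j]]; rewrite ?mulrDr ?scalerAr ?mulr0 //.
  rewrite /weyl_monomial mulrA weyl_q_p_exp mulrDl -mulrA -exprS -scalerAl.
  by apply: spanD; [|apply: spanZ];
    [apply: (span_y (i, j.+1))|apply: (span_y (i.-1, j))].
- by rewrite -scalerAl mul1r; apply: spanZ.
- by rewrite mulrDl; apply: spanD; [apply: IHa|apply: IHb].
- by rewrite mulNr -scaleN1r; apply: spanZ; apply: IHa.
- by rewrite -mulrA; apply: IHa; apply: IHb.
Qed.

Lemma weyl_monomial_basis : [pchar K] =i pred0 -> is_basis y.
Proof.
move=> charK f; have [l ->] := weyl_monomial_span f.
by exists l; split => // l' /(weyl_monomial_inj charK).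
Qed.

End MonomialBasis.

(* R ∪ {-oo} is the part of \bar R below +oo. *)
Record degree_map (R : realType) (S : nzRingType) (u : S -> \bar R) : Prop := {
  degree_ltpinfty : forall f, (u f < +oo)%E;
  degreeM : forall f g, u (f * g) = (u f + u g)%E;
  degreeD : forall f g, (u (f + g)%R <= maxe (u f) (u g))%E;
  degree_eqNy : forall f, u f = -oo%E <-> f = 0
}.

Definition degree_values (R : realType) (S : nzRingType) (u : S -> \bar R) :
    set (\bar R) :=
  [set u f | f in [set f | f != 0]].

Definition degree_trivial (R : realType) (S : nzRingType) (u : S -> \bar R) :
    Prop :=
  degree_values u = [set 0%E].

Definition degree_over (R : realType) (K : fieldType) (A : algType K)
    (u : A -> \bar R) : Prop :=
  degree_trivial (fun c : K => u c%:A).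

Definition degree_equiv (R : realType) (S : nzRingType) (u1 u2 : S -> \bar R) :
    Prop :=
  exists2 c : R, 0 < c & forall f, f != 0 -> u2 f = (c%:E * u1 f)%E.

Definition evaluation_basis (R : realType) (K : fieldType) (A : algType K)
    (I : choiceType) (u : A -> \bar R) (y : I -> A) : Prop :=
  is_basis y /\
  forall l : {fsfun I -> K with 0}, lincomb y l != 0 ->
    u (lincomb y l) = ereal_sup [set u (y i) | i in [set i | l i != 0]].

(* D, with the embedding iota, is the quotient division ring of A. *)
Record quotient_division_ring (A : nzRingType) (D : unitRingType)
    (iota : {rmorphism A -> D}) : Prop := {
  qdr_division : forall d : D, d != 0 -> d \is a GRing.unit;
  qdr_inj : injective iota;
  qdr_frac : forall d : D, exists z w : A,
    w != 0 /\ d = iota z * (iota w)^-1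
}.

(* G is an additive group of reals isomorphic to the integers. *)
Definition infinite_cyclic (R : realType) (G : set (\bar R)) : Prop :=
  exists phi : {additive int -> R},
    injective phi /\ G = [set (phi n)%:E | n in setT].

Definition degree_discrete (R : realType) (A : nzRingType) (D : unitRingType)
    (iota : {rmorphism A -> D}) (u : A -> \bar R) : Prop :=
  exists u' : D -> \bar R,
    [/\ degree_map u', (forall f, u' (iota f) = u f) &
        infinite_cyclic (degree_values u')].

(* The coordinates of f in the monomial basis: in characteristic 0 they exist
   and are unique by
   weyl_monomial_basis, so the default value of xget is never used. *)
Definition weyl_coef (K : fieldType) (f : weyl K) :
    {fsfun nat * nat -> K with 0} :=
  xget [fsfun] [set l | f = lincomb (@weyl_monomial K) l].

Definition vdeg (R : realType) (K : fieldType) (rho sigma : R) (f : weyl K) :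
    \bar R :=
  if f == 0 then -oo%E
  else ereal_sup [set (rho * ij.1%:R + sigma * ij.2%:R)%:E
                 | ij in [set ij | weyl_coef f ij != 0]].

Definition Q_dependent (R : realType) (x y : R) : Prop :=
  exists a b : rat, (a, b) <> (0, 0) /\ ratr a * x + ratr b * y = 0.

(* Main.v *)
(* Refining the weight rho i + sigma j by the total degree i + j, and then by i,
   gives a monomial order on the basis p^i q^j.  Rewriting q p as p q + 1 only
   adds terms with both exponents lowered by one, so for rho + sigma >= 0 the
   leading monomial of a product is the product of the leading monomials, and
   v_{rho,sigma} is a degree map.  Conversely, a degree map is determined on the
   monomials by its values at p and q, and u(qp - pq) = 0 forces
   rho + sigma >= 0.  Any degree map extends to the quotient division ring by
   u(z) - u(w); the value group is then Z rho + Z sigma, which is infinite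
   cyclic exactly when rho and sigma are commensurable and not both zero. *)

Require Import Defs.
From HB Require Import structures.
From mathcomp Require Import all_boot all_order all_algebra.
From mathcomp Require Import finmap.
From mathcomp Require Import all_classical all_reals ereal.
From mathcomp Require Import zify ring lra.

Set Implicit Arguments.
Unset Strict Implicit.
Unset Printing Implicit Defensive.

Import Order.TTheory GRing.Theory Num.Theory.
Local Open Scope classical_set_scope.
Local Open Scope ring_scope.

(** * Coordinates in the monomial basis *)

Lemma weyl_coefK (K : fieldType) (f : weyl K) :
  lincomb (@weyl_monomial K) (weyl_coef f) = f.
Proof.
have [l fl] := weyl_monomial_span f.
by rewrite -(@xgetPex _ [fsfun] [set l | f = lincomb (@weyl_monomial K) l]) //;
  exists l.
Qed.

Lemma weyl_coef_lincomb (K : fieldType) (charK : [pchar K] =i pred0)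
    (l : {fsfun nat * nat -> K with 0}) :
  weyl_coef (lincomb (@weyl_monomial K) l) = l.
Proof. by apply: (weyl_monomial_inj charK); rewrite weyl_coefK. Qed.

(** The pointwise combination over the union of both supports represents [c *: f + g], and
    coordinates are unique in characteristic 0. *)
Lemma weyl_coefP (K : fieldType) (charK : [pchar K] =i pred0) (c : K)
    (f g : weyl K) x :
  weyl_coef (c *: f + g) x = c * weyl_coef f x + weyl_coef g x.
Proof.
set S := (finsupp (weyl_coef f) `|` finsupp (weyl_coef g))%fset.
pose l := [fsfun x in S => c * weyl_coef f x + weyl_coef g x | 0 : K].
have -> : c *: f + g = lincomb (@weyl_monomial K) l.
  rewrite -{1}(weyl_coefK f) -{1}(weyl_coefK g).
  rewrite (@lincomb_wider _ S l) ?finsupp_sub //.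
  rewrite (@lincomb_wider _ S (weyl_coef f)) ?fsubsetUl //.
  rewrite (@lincomb_wider _ S (weyl_coef g)) ?fsubsetUr //.
  rewrite scaler_sumr -big_split /=; apply: eq_big_seq => z zS.
  by rewrite fsfunE zS scalerA scalerDl.
rewrite weyl_coef_lincomb // fsfunE; case: ifPn => //.
rewrite in_fsetU negb_or => /andP[h1 h2].
by rewrite !fsfun_dflt // mulr0 addr0.
Qed.

Lemma weyl_coef0 (K : fieldType) (charK : [pchar K] =i pred0) x :
  weyl_coef (0 : weyl K) x = 0.
Proof.
by have := weyl_coefP charK (-1) 0 0 x; rewrite scaler0 addr0 mulN1r addNr.
Qed.

Lemma weyl_coefD (K : fieldType) (charK : [pchar K] =i pred0)
    (f g : weyl K) x :
  weyl_coef (f + g) x = weyl_coef f x + weyl_coef g x.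
Proof. by rewrite -[f in LHS]scale1r weyl_coefP // mul1r. Qed.

Lemma weyl_coefZ (K : fieldType) (charK : [pchar K] =i pred0) (c : K)
    (f : weyl K) x :
  weyl_coef (c *: f) x = c * weyl_coef f x.
Proof. by rewrite -[_ *: _]addr0 weyl_coefP // weyl_coef0 // addr0. Qed.

Lemma weyl_coef_monomial (K : fieldType) (charK : [pchar K] =i pred0) x z :
  weyl_coef (weyl_monomial K x) z = (z == x)%:R.
Proof.
pose l := [fsfun z in [fset x]%fset => 1 | 0 : K].
have -> : weyl_monomial K x = lincomb (@weyl_monomial K) l.
  rewrite (@lincomb_wider _ [fset x]%fset) ?finsupp_sub //.
  by rewrite big_seq_fset1 fsfunE in_fset1 eqxx scale1r.
by rewrite weyl_coef_lincomb // fsfunE in_fset1; case: eqP.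
Qed.

Lemma weyl_coef_eq0 (K : fieldType) (f : weyl K) :
  (forall x, weyl_coef f x = 0) -> f = 0.
Proof.
move=> f0; rewrite -(weyl_coefK f) /lincomb big1 // => x _.
by rewrite f0 scale0r.
Qed.

(** Builds [f] one term at a time while keeping a condition [Q] on the monomials that occur, such as
    a bound by the leading one. *)
Lemma weyl_support_ind (K : fieldType) (Q : nat * nat -> Prop)
    (P : weyl K -> Prop) :
  P 0 -> (forall c x f, Q x -> P f -> P (c *: weyl_monomial K x + f)) ->
  forall f, (forall x, weyl_coef f x != 0 -> Q x) -> P f.
Proof.
move=> P0 PS f Qf; rewrite -(weyl_coefK f) /lincomb big_seq.
elim/big_rec: _ => // x g; rewrite mem_finsupp => /Qf; exact: PS.
Qed.

(** * Weights and the monomial order *)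

Definition madd (x z : nat * nat) : nat * nat := (x.1 + z.1, x.2 + z.2)%N.

Definition weight (R : realType) (rho sigma : R) (x : nat * nat) : R :=
  rho * x.1%:R + sigma * x.2%:R.

Lemma weightD (R : realType) (rho sigma : R) x z :
  weight rho sigma (madd x z) = weight rho sigma x + weight rho sigma z.
Proof. by rewrite /weight /= !natrD; lra. Qed.

(* Total degree and then the exponent of p break ties between equal weights,
   which gives a monomial order even when rho + sigma = 0. *)
Definition mkey (R : realType) (rho sigma : R) (x : nat * nat) :
    R *l (nat *l nat) :=
  (weight rho sigma x, ((x.1 + x.2)%N, x.1)).

Lemma mkey_ltE (R : realType) (rho sigma : R) x z :
  (mkey rho sigma x < mkey rho sigma z)%O =
  (weight rho sigma x < weight rho sigma z) ||
  (weight rho sigma x == weight rho sigma z) &&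
   ((x.1 + x.2 < z.1 + z.2) ||
    (x.1 + x.2 == z.1 + z.2) && (x.1 < z.1))%N.
Proof.
rewrite /mkey !ltxi_pair !leEnat !ltEnat /=.
case: (ltgtP (weight rho sigma x)) => //= _.
by case: (ltngtP (x.1 + x.2)%N).
Qed.

(** Total degree and exponent of p together determine both exponents, so distinct monomials never
    tie. *)
Lemma mkey_inj (R : realType) (rho sigma : R) : injective (mkey rho sigma).
Proof. by move=> [i j] [k l] [_ /= ? ?]; congr pair; lia. Qed.

Lemma mkey_ltD (R : realType) (rho sigma : R) x z e :
  (mkey rho sigma x < mkey rho sigma z)%O ->
  (mkey rho sigma (madd x e) < mkey rho sigma (madd z e))%O.
Proof.
rewrite !mkey_ltE !weightD ltrD2r (inj_eq (addIr _)) /=.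
by case/orP=> [->//|/andP[-> h]]; apply/orP; right; lia.
Qed.

(** The weight grows by [rho + sigma]; if that is 0, the total degree, which grows by 2, decides.
    This makes the correction terms from [q p = p q + 1] lower. *)
Lemma mkey_lt_diag (R : realType) (rho sigma : R) i j :
  0 <= rho + sigma -> (mkey rho sigma (i, j) < mkey rho sigma (i.+1, j.+1))%O.
Proof.
move=> h; rewrite mkey_ltE /weight /=.
have -> : rho * i.+1%:R + sigma * j.+1%:R
    = rho * i%:R + sigma * j%:R + (rho + sigma).
  by rewrite -!natr1; lra.
rewrite ltrDl; case: ltgtP h => //= <- _; rewrite addr0 eqxx /=; lia.
Qed.

(* The coefficient c may vanish: then f lies strictly below the monomial a. *)
Definition leading (R : realType) (K : fieldType) (rho sigma : R)
    (a : nat * nat) (c : K) (f : weyl K) : Prop :=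
  weyl_coef f a = c /\
  forall x, weyl_coef f x != 0 -> (mkey rho sigma x <= mkey rho sigma a)%O.

(** * Leading monomials of products *)

Section Leading.
Variables (R : realType) (K : fieldType) (rho sigma : R).
Hypotheses (charK : [pchar K] =i pred0) (rs_ge0 : 0 <= rho + sigma).
Local Notation y := (weyl_monomial K).
Local Notation key := (mkey rho sigma).
Local Notation lead := (@leading R K rho sigma).

Lemma leading0 a : lead a 0 0.
Proof. by split=> [|x]; rewrite weyl_coef0 ?eqxx. Qed.

Lemma leadingP a k c d f g :
  lead a c f -> lead a d g -> lead a (k * c + d) (k *: f + g).
Proof.
move=> [<- f_le] [<- g_le]; split=> [|x]; first by rewrite weyl_coefP.
rewrite weyl_coefP //.
have [->|/f_le //] := eqVneq (weyl_coef f x) 0.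
have [->|/g_le //] := eqVneq (weyl_coef g x) 0.
by rewrite mulr0 addr0 eqxx.
Qed.

(** A nonzero coefficient at [b] would contradict the bound by [a]. Lower-order terms are absorbed
    in this form. *)
Lemma leading_lt a b c f : (key a < key b)%O -> lead a c f -> lead b 0 f.
Proof.
move=> ab [_ f_le]; split=> [|x /f_le xa]; last exact: le_trans xa (ltW ab).
by apply/eqP; apply: contraTT ab => /f_le; rewrite leNgt.
Qed.

Lemma leading_monomial a : lead a 1 (y a).
Proof.
split=> [|x]; rewrite weyl_coef_monomial // ?eqxx //.
by case: (x =P a) => [->|_]; rewrite ?lexx ?eqxx.
Qed.

(** Expand [f] into monomials: the term at [a] contributes [c * d], and every other term is shifted
    by [e] to a place strictly below [madd a e]. *)
Lemma leading_linear (h : weyl K -> weyl K) a c d e f :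
  (forall k u v, h (k *: u + v) = k *: h u + h v) ->
  (forall x, lead (madd x e) d (h (y x))) ->
  lead a c f -> lead (madd a e) (c * d) (h f).
Proof.
move=> hP hy [<- f_le].
have h0 : h 0 = 0.
  by have := hP (-1) 0 0; rewrite scaler0 addr0 scaleN1r addNr.
move: f f_le; apply: weyl_support_ind.
  by rewrite h0 weyl_coef0 // mul0r; apply: leading0.
move=> k x f xa IH; rewrite hP weyl_coefP // weyl_coef_monomial // mulrDl.
rewrite -mulrA; apply: leadingP => //.
have [->|ax] := eqVneq a x; first by rewrite mul1r; apply: hy.
rewrite mul0r; apply: leading_lt (hy x); apply: mkey_ltD.
by rewrite lt_neqAle xa andbT; apply: contra_neq ax => /mkey_inj ->.
Qed.

Lemma leading_p b d f :
  lead b d f -> lead (madd b (1, 0)%N) d (weyl_p K * f).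
Proof.
rewrite -[d in X in _ -> X]mulr1.
apply: leading_linear => [k u v|[k l]]; first by rewrite mulrDr scalerAr.
rewrite /weyl_monomial mulrA -exprS /=.
by have := leading_monomial (k.+1, l)%N; rewrite /madd /= addn0 addn1.
Qed.

(** On monomials, q p^k q^l = p^k q^(l+1) + k p^(k-1) q^l, and the last term lies one diagonal step
    below the first. *)
Lemma leading_q b d f :
  lead b d f -> lead (madd b (0, 1)%N) d (weyl_q K * f).
Proof.
rewrite -[d in X in _ -> X]mulr1.
apply: leading_linear => [k u v|[k l]]; first by rewrite mulrDr scalerAr.
rewrite /weyl_monomial mulrA weyl_q_p_exp mulrDl -mulrA -exprS addrC /=.
rewrite -scalerAl.
have lower : lead (k, l.+1)%N 0 (k%:R *: y (k.-1, l)%N).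
  (* For [k = 0] the exponent [k.-1] truncates to 0, but the coefficient [k%:R] vanishes. *)
  case: k => [|k]; first by rewrite scale0r; apply: leading0.
  have lt_k : lead (k.+1, l.+1)%N 0 (y (k, l)%N).
    by apply: leading_lt (leading_monomial _); apply: mkey_lt_diag.
  by have := leadingP k.+1%:R lt_k (leading0 _); rewrite mulr0 !addr0.
have := leadingP 1 lower (leading_monomial (k, l.+1)%N).
by rewrite scale1r mulr0 add0r /madd /= addn0 addn1.
Qed.

Lemma leading_monomialM x b d g : lead b d g -> lead (madd b x) d (y x * g).
Proof.
case: x => i j gb; rewrite /weyl_monomial /= -mulrA.
have {gb} : lead (madd b (0, j)%N) d (weyl_q K ^+ j * g).
  elim: j => [|j IH].
    by rewrite mul1r /madd /= !addn0 -surjective_pairing.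
  have := leading_q IH.
  by rewrite mulrA -exprS /madd /= !addn0 -addnA addn1.
move: (_ * g) => h {}gb; elim: i => [|i IH]; first by rewrite mul1r.
have := leading_p IH.
by rewrite mulrA -exprS /madd /= !addn0 -addnA addn1.
Qed.

(** Right multiplication by [g] is linear, so it is enough to multiply [g] on the left by
    monomials. *)
Lemma leadingM a b c d f g :
  lead a c f -> lead b d g -> lead (madd a b) (c * d) (f * g).
Proof.
move=> fa gb; move: fa.
apply: (@leading_linear (fun u => u * g)) => [k u v|x].
  by rewrite mulrDl scalerAl.
have -> : madd x b = madd b x by congr pair; rewrite addnC.
exact: leading_monomialM.
Qed.

Lemma leading_exists f : f != 0 -> exists a c, c != 0 /\ lead a c f.
Proof.
move=> f0; have [x0 fx0] : exists x, weyl_coef f x != 0.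
  apply/not_existsP => h; move/eqP: f0; apply; apply: weyl_coef_eq0 => x.
  by apply/eqP/negP => /negP; apply: h.
rewrite -mem_finsupp in fx0.
(* The support is a finite type, nonempty because of [x0], so the key has a maximum on it. *)
case: (@arg_maxP _ _ _ [` fx0]%fset predT (fun z => key (val z)) isT).
move=> a _ a_max; exists (val a), (weyl_coef f (val a)).
split; first by rewrite -mem_finsupp; apply: valP.
split=> // x; rewrite -mem_finsupp => fx; exact: (a_max [` fx]%fset isT).
Qed.

End Leading.

(** * The weighted degree as a degree map *)

Section Vdeg.
Variables (R : realType) (K : fieldType) (charK : [pchar K] =i pred0).
Implicit Types (rho sigma : R) (f g : weyl K).
Local Notation y := (weyl_monomial K).

(** For [f = 0] the support is empty, and the supremum of the empty set is [-oo]. *)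
Lemma vdegE rho sigma f : vdeg rho sigma f =
  ereal_sup [set (weight rho sigma x)%:E | x in [set x | weyl_coef f x != 0]].
Proof.
rewrite /vdeg; case: eqP => // ->; rewrite -(@ereal_sup0 R).
congr ereal_sup; apply/seteqP; split=> // z [x].
by rewrite /= weyl_coef0 // eqxx.
Qed.

Lemma vdeg_le rho sigma f M : (vdeg rho sigma f <= M)%E <->
  forall x, weyl_coef f x != 0 -> ((weight rho sigma x)%:E <= M)%E.
Proof.
rewrite vdegE; split=> [h x fx|h].
  by apply: le_trans h; apply: ereal_sup_ubound; exists x.
by apply: ge_ereal_sup => _ [x fx <-]; apply: h.
Qed.

Lemma vdeg_max rho sigma f a : weyl_coef f a != 0 ->
  (forall x, weyl_coef f x != 0 -> weight rho sigma x <= weight rho sigma a) ->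
  vdeg rho sigma f = (weight rho sigma a)%:E.
Proof.
move=> fa f_le; apply/eqP; rewrite eq_le; apply/andP; split.
  by apply/vdeg_le => x /f_le.
exact: (iffLR (vdeg_le _ _ _ _) (lexx _)).
Qed.

(** The key compares weights first, so a leading monomial has maximal weight. *)
Lemma vdeg_leading rho sigma f a c : c != 0 ->
  leading rho sigma a c f -> vdeg rho sigma f = (weight rho sigma a)%:E.
Proof.
move=> c0 [fa f_le]; apply: vdeg_max => [|x /f_le]; first by rewrite fa.
by rewrite /mkey lexi_pair => /andP[].
Qed.

Lemma vdeg_monomial rho sigma x :
  vdeg rho sigma (y x) = (weight rho sigma x)%:E.
Proof. exact: (vdeg_leading (oner_neq0 K) (leading_monomial _ _ charK x)). Qed.

Lemma vdeg_p rho sigma : vdeg rho sigma (weyl_p K) = rho%:E.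
Proof.
have := vdeg_monomial rho sigma (1, 0)%N.
by rewrite /weyl_monomial /= mulr1 => ->; rewrite /weight mulr1 mulr0 addr0.
Qed.

Lemma vdeg_q rho sigma : vdeg rho sigma (weyl_q K) = sigma%:E.
Proof.
have := vdeg_monomial rho sigma (0, 1)%N.
by rewrite /weyl_monomial /= mul1r => ->; rewrite /weight mulr1 mulr0 add0r.
Qed.

Lemma weyl_monomial_neq0 x : y x != 0.
Proof.
apply/eqP => /(congr1 (fun f => weyl_coef f x)).
by rewrite weyl_coef_monomial // eqxx weyl_coef0 //; apply/eqP/oner_neq0.
Qed.

Lemma vdeg0 rho sigma : vdeg rho sigma (0 : weyl K) = -oo%E.
Proof. by rewrite /vdeg eqxx. Qed.

Lemma vdeg_neq0 rho sigma f : f != 0 ->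
  exists2 a, weyl_coef f a != 0 & vdeg rho sigma f = (weight rho sigma a)%:E.
Proof.
move=> /(@leading_exists _ _ rho sigma)[a [c [c0 fa]]]; exists a.
  by rewrite fa.1.
exact: vdeg_leading fa.
Qed.

(** Multiplicativity comes from leading monomials, whose coefficients have nonzero product in a
    field; the bound on sums holds because the support of a sum lies in the union of the
    supports. *)
Lemma vdeg_degree_map rho sigma :
  0 <= rho + sigma -> degree_map (@vdeg R K rho sigma).
Proof.
move=> rs; split=> [f|f g|f g|f].
- have [->|/(vdeg_neq0 rho sigma)[a _ ->]] := eqVneq f 0.
    by rewrite vdeg0.
  exact: ltry.
- have [->|f0] := eqVneq f 0; first by rewrite mul0r vdeg0 addNye.
  have [->|g0] := eqVneq g 0; first by rewrite mulr0 vdeg0 addeNy.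
  have [a [c [c0 fa]]] := leading_exists rho sigma f0.
  have [b [d [d0 gb]]] := leading_exists rho sigma g0.
  rewrite (vdeg_leading _ (leadingM charK rs fa gb)) ?mulf_neq0 //.
  by rewrite (vdeg_leading _ fa) // (vdeg_leading _ gb) // weightD.
- apply/vdeg_le => x; rewrite weyl_coefD // le_max => fgx.
  have [fx|fx] := eqVneq (weyl_coef f x) 0.
    apply/orP; right; apply: (iffLR (vdeg_le _ _ g _) (lexx _)).
    by rewrite fx add0r in fgx.
  by apply/orP; left; apply: (iffLR (vdeg_le _ _ f _) (lexx _)).
- split=> [|->]; last exact: vdeg0.
  by apply: contraPP => /eqP/(vdeg_neq0 rho sigma)[a _ ->].
Qed.

End Vdeg.

(** * Extension of a degree map to the quotient division ring *)

Section DegreeMap.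
Variables (R : realType) (A : nzRingType) (u : A -> \bar R).
Hypothesis uP : degree_map u.

Lemma degree_finite (f : A) : f != 0 -> exists r : R, u f = r%:E.
Proof.
move=> f0; have := degree_ltpinfty uP f; case uf: (u f) => [r||] // _.
  by exists r.
by move/(degree_eqNy uP): uf => /eqP; rewrite (negPf f0).
Qed.

Lemma degree_mulf_neq0 (f g : A) : f != 0 -> g != 0 -> f * g != 0.
Proof.
move=> /degree_finite[r uf] /degree_finite[s ug].
by apply/eqP => /(degree_eqNy uP); rewrite (degreeM uP) uf ug.
Qed.

Lemma degree1 : u 1 = 0%E.
Proof.
have [r u1] := degree_finite (oner_neq0 A).
have := degreeM uP 1 1; rewrite mulr1 u1 => -[] r_eq.
by congr (_%:E); lra.
Qed.

Lemma degreeN f : u (- f) = u f.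
Proof.
have [r uN1] : exists r : R, u (- 1) = r%:E.
  by apply: degree_finite; rewrite oppr_eq0 oner_neq0.
have := degreeM uP (- 1) (- 1); rewrite mulrNN mulr1 degree1 uN1 => -[] r_eq.
by rewrite -mulN1r (degreeM uP) uN1 (_ : r = 0) ?add0e //; lra.
Qed.

Lemma degreeX f (r : R) n : u f = r%:E -> u (f ^+ n) = (r * n%:R)%:E.
Proof.
move=> uf; elim: n => [|n IH]; first by rewrite mulr0 degree1.
by rewrite exprS (degreeM uP) IH uf -natr1 mulrDr mulr1 addrC.
Qed.

Variables (D : unitRingType) (iota : {rmorphism A -> D}).
Hypothesis DP : quotient_division_ring iota.

Lemma qdr_unit w : w != 0 -> iota w \is a GRing.unit.
Proof.
move=> w0; apply: (qdr_division DP); apply: contra_neq w0 => iw.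
by apply: (qdr_inj DP); rewrite iw rmorph0.
Qed.

(* The right Ore condition holds because w^-1 z is again a right fraction. *)
Lemma qdr_ore w z : w != 0 -> exists s t,
  [/\ t != 0, z * t = w * s & (iota w)^-1 * iota z = iota s * (iota t)^-1].
Proof.
move=> w0; have [s [t [t0 e]]] := qdr_frac DP ((iota w)^-1 * iota z).
exists s, t; split=> //; apply: (qdr_inj DP); rewrite !rmorphM.
rewrite -(mulVKr (qdr_unit w0) (iota z)) e -!mulrA.
by rewrite mulVr ?mulr1 ?qdr_unit.
Qed.

(** Bring both fractions to a common denominator [w * s = w' * t]; then [z * s = z' * t], and
    subtracting the two degree equations cancels [s] and [t]. *)
Lemma qdr_degree_eq z w z' w' : w != 0 -> w' != 0 ->
  iota z * (iota w)^-1 = iota z' * (iota w')^-1 ->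
  (u z - u w = u z' - u w')%E.
Proof.
move=> w0 w'0 zw; have [s [t [t0 ws _]]] := qdr_ore w' w0.
have s0 : s != 0.
  by apply: contra_neq (degree_mulf_neq0 w'0 t0) => s0; rewrite ws s0 mulr0.
have zs : z * s = z' * t.
  apply: (qdr_inj DP); rewrite !rmorphM.
  rewrite -(mulrVK (qdr_unit w0) (iota z)) zw -!mulrA -rmorphM -ws rmorphM.
  by rewrite mulKr ?qdr_unit.
have := degreeM uP z s; rewrite zs (degreeM uP).
have := degreeM uP w s; rewrite -ws (degreeM uP).
have [[a ->] [b ->]] := (degree_finite w0, degree_finite w'0).
have [[c ->] [d ->]] := (degree_finite s0, degree_finite t0).
case: (u z) (u z') => [x||] [x'||] //= [e1] [e2].
by congr (_%:E); lra.
Qed.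

Definition qdr_degree (d : D) : \bar R :=
  xget -oo%E [set e | exists z w,
    [/\ w != 0, d = iota z * (iota w)^-1 & e = (u z - u w)%E]].

Lemma qdr_degreeE z w : w != 0 ->
  qdr_degree (iota z * (iota w)^-1) = (u z - u w)%E.
Proof.
move=> w0; rewrite /qdr_degree; case: xgetP => [_ -> [z' [w' [w'0 e ->]]]|].
  exact: qdr_degree_eq (esym e).
by move=> /(_ (u z - u w)%E) []; exists z, w.
Qed.

Lemma qdr_degree_iota f : qdr_degree (iota f) = u f.
Proof.
have := qdr_degreeE f (oner_neq0 A).
by rewrite rmorph1 invr1 mulr1 degree1 sube0.
Qed.

(** Moving w1^-1 past z2 by the Ore condition turns the product into the single fraction (z1 s)(w2
    t)^-1 with z2 t = w1 s. *)
Lemma qdr_degreeM d1 d2 :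
  qdr_degree (d1 * d2) = (qdr_degree d1 + qdr_degree d2)%E.
Proof.
have [z1 [w1 [w10 ->]]] := qdr_frac DP d1.
have [z2 [w2 [w20 ->]]] := qdr_frac DP d2.
have [s [t [t0 ts e]]] := qdr_ore z2 w10.
have -> : iota z1 * (iota w1)^-1 * (iota z2 * (iota w2)^-1) =
    iota (z1 * s) * (iota (w2 * t))^-1.
  by rewrite !rmorphM invrM ?qdr_unit // !mulrA -(mulrA (iota z1)) e !mulrA.
rewrite !qdr_degreeE ?degree_mulf_neq0 // !(degreeM uP).
have := degreeM uP w1 s; rewrite -ts (degreeM uP).
have [[a ->] [b ->]] := (degree_finite w10, degree_finite w20).
have [c ->] := degree_finite t0.
(* The elements [z1], [z2] and [s] may be 0, so their degrees are only known to differ from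
   [+oo]. *)
have := degree_ltpinfty uP z1; have := degree_ltpinfty uP s.
have := degree_ltpinfty uP z2.
case: (u z1) (u z2) (u s) => [x||] [x'||] [y||] //= _ _ _ [e1].
by congr (_%:E); lra.
Qed.

(** Over the common denominator [w1 * s = w2 * t] the numerators add, and the bound is inherited
    from [u]. *)
Lemma qdr_degreeD d1 d2 :
  (qdr_degree (d1 + d2) <= maxe (qdr_degree d1) (qdr_degree d2))%E.
Proof.
have [z1 [w1 [w10 ->]]] := qdr_frac DP d1.
have [z2 [w2 [w20 ->]]] := qdr_frac DP d2.
have [s [t [t0 ts _]]] := qdr_ore w2 w10.
have s0 : s != 0.
  by apply: contra_neq (degree_mulf_neq0 w20 t0) => s0; rewrite ts s0 mulr0.
have frac z w v : w != 0 -> v != 0 ->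
    iota z * (iota w)^-1 = iota (z * v) * (iota (w * v))^-1.
  by move=> w0 v0; rewrite !rmorphM invrM ?qdr_unit // mulrA mulrK ?qdr_unit.
rewrite (frac z1 w1 s) // (frac z2 w2 t) // ts -mulrDl -rmorphD.
have ws0 := degree_mulf_neq0 w10 s0; rewrite !qdr_degreeE //.
have [r ->] := degree_finite ws0.
have := degreeD uP (z1 * s) (z2 * t); rewrite !le_max.
by case/orP=> h; apply/orP; [left|right]; apply: leeD2r.
Qed.

Lemma qdr_degree_map : degree_map qdr_degree.
Proof.
split=> [d|||d]; [|exact: qdr_degreeM|exact: qdr_degreeD|].
  have [z [w [w0 ->]]] := qdr_frac DP d; rewrite qdr_degreeE //.
  have [r ->] := degree_finite w0; have := degree_ltpinfty uP z.
  by case: (u z) => // x _; apply: ltry.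
have [z [w [w0 ->]]] := qdr_frac DP d; rewrite qdr_degreeE //.
have [r uw] := degree_finite w0; rewrite uw.
have [->|z0] := eqVneq z 0.
  by rewrite (iffRL (degree_eqNy uP 0)) // rmorph0 mul0r.
have [x ->] := degree_finite z0; split=> // /(congr1 (fun x => x * iota w)).
rewrite mulrVK ?qdr_unit // mul0r -(rmorph0 iota) => /(qdr_inj DP)/eqP.
by rewrite (negPf z0).
Qed.

Lemma qdr_degree_values : degree_values qdr_degree =
  [set e | exists z w, [/\ z != 0, w != 0 & e = (u z - u w)%E]].
Proof.
apply/seteqP; split=> e /=.
  move=> [d /= d0 <-]; have [z [w [w0 dE]]] := qdr_frac DP d.
  exists z, w; split=> //; last by rewrite dE qdr_degreeE.
  by apply: contra_neq d0 => z0; rewrite dE z0 rmorph0 mul0r.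
move=> [z [w [z0 w0 ->]]]; exists (iota z * (iota w)^-1).
  apply/eqP => /(degree_eqNy qdr_degree_map); rewrite qdr_degreeE //.
  by have [[a ->] [b ->]] := (degree_finite w0, degree_finite z0).
exact: qdr_degreeE.
Qed.

End DegreeMap.

(** * Commensurable weights *)

Lemma Q_dependentP (R : realType) (rho sigma : R) :
  Q_dependent rho sigma <-> exists a b : int,
    (a, b) <> (0, 0) /\ a%:~R * rho + b%:~R * sigma = 0.
Proof.
split=> [[a [b [ab0 e]]]|[a [b [ab0 e]]]]; last first.
  exists a%:~R, b%:~R; rewrite !ratr_int; split=> // -[/eqP a0 /eqP b0].
  by apply: ab0; move: a0 b0; rewrite !intr_eq0 => /eqP-> /eqP->.
(* The rational relation is multiplied by both denominators. *)
exists (numq a * denq b), (numq b * denq a); split.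
  move=> [/eqP a0 /eqP b0]; apply: ab0; move: a0 b0.
  by rewrite !mulf_eq0 !denq_eq0 !orbF !numq_eq0 => /eqP-> /eqP->.
have da : (denq a)%:~R != 0 :> R by rewrite intr_eq0 denq_eq0.
have db : (denq b)%:~R != 0 :> R by rewrite intr_eq0 denq_eq0.
have -> : (numq a * denq b)%:~R * rho + (numq b * denq a)%:~R * sigma =
    (denq a)%:~R * (denq b)%:~R * (ratr a * rho + ratr b * sigma) :> R.
  by rewrite /ratr !rmorphM /=; field; rewrite da db.
by rewrite e mulr0.
Qed.

(** Dividing the integer relation by the gcd leaves coprime [a'], [b'] with [a' rho + b' sigma = 0],
    so [(rho, sigma)] is a real multiple [t] of [(b', - a')]. *)
Lemma Q_dependent_coprime (R : realType) (rho sigma : R) :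
  0 <= rho + sigma -> (rho, sigma) <> (0, 0) -> Q_dependent rho sigma ->
  exists m n : int, exists c : R,
    [/\ coprimez m n, 0 <= m + n, 0 < c, rho = c * m%:~R & sigma = c * n%:~R].
Proof.
move=> rs rs0 /Q_dependentP[a [b [ab0 e]]].
have g0 : gcdz a b != 0.
  rewrite gcdz_eq0; apply/andP => -[/eqP a0 /eqP b0].
  by apply: ab0; rewrite a0 b0.
have [a' aE] := dvdzP (dvdz_gcdl a b).
have [b' bE] := dvdzP (dvdz_gcdr a b).
have [x [z xz]] := Bezoutz a b.
have {xz} bezout : x * a' + z * b' = 1.
  by apply: (mulIf g0); rewrite mul1r -[RHS]xz {2}aE {3}bE; ring.
have {e} e : a'%:~R * rho + b'%:~R * sigma = 0.
  have gR : (gcdz a b)%:~R != 0 :> R by rewrite intr_eq0.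
  apply: (mulfI gR); rewrite mulr0 -[RHS]e {2}aE {3}bE !rmorphM /=; ring.
have bezR : x%:~R * a'%:~R + z%:~R * b'%:~R = 1 :> R.
  by rewrite -!rmorphM -rmorphD bezout.
(* Solving [rho = t b'], [sigma = - t a'] for [t] by means of [x a' + z b' = 1] gives this value. *)
pose t : R := z%:~R * rho - x%:~R * sigma.
have rhoE : rho = t * b'%:~R.
  transitivity ((x%:~R * a'%:~R + z%:~R * b'%:~R) * rho
    - x%:~R * (a'%:~R * rho + b'%:~R * sigma)).
    by rewrite bezR e mulr0 subr0 mul1r.
  by rewrite /t; ring.
have sigmaE : sigma = t * (- a')%:~R.
  transitivity ((x%:~R * a'%:~R + z%:~R * b'%:~R) * sigma
    - z%:~R * (a'%:~R * rho + b'%:~R * sigma)).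
    by rewrite bezR e mulr0 subr0 mul1r.
  by rewrite /t rmorphN /=; ring.
have cop : coprimez a' b' by apply/coprimezP; exists (x, z).
have ge0 m n c : 0 < c -> rho = c * m%:~R -> sigma = c * n%:~R ->
    (0 <= m + n)%R.
  move=> c0 rE sE; move: rs.
  by rewrite rE sE -mulrDr -rmorphD pmulr_rge0 // ler0z.
(* A negative [t] is made positive by negating both integers; [t = 0] would make both weights 0. *)
case: (ltgtP t 0) => [t0|t0|t0].
- have rE : rho = - t * (- b')%:~R by rewrite rmorphN mulrNN.
  have sE : sigma = - t * a'%:~R by rewrite sigmaE rmorphN mulrN mulNr.
  exists (- b'), a', (- t); split=> //; rewrite ?oppr_gt0 //.
    by rewrite coprimeNz coprimez_sym.
  by apply: ge0 rE sE; rewrite oppr_gt0.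
- exists b', (- a'), t; split=> //; last exact: ge0 rhoE sigmaE.
  by rewrite coprimezN coprimez_sym.
- by case: rs0; rewrite rhoE sigmaE t0 !mul0r.
Qed.

(** * Classification, equivalence and discreteness *)

Section WeightedDegree.
Variables (R : realType) (K : fieldType) (charK : [pchar K] =i pred0).
Local Notation y := (weyl_monomial K).

Lemma vdeg_alg (rho sigma : R) (c : K) :
  c != 0 -> vdeg rho sigma (c%:A : weyl K) = 0%E.
Proof.
move=> c0; have -> : c%:A = c *: y (0, 0)%N :> weyl K.
  by rewrite /weyl_monomial mulr1.
rewrite (@vdeg_max _ _ charK _ _ _ (0, 0)%N) => [||x].
- by rewrite /weight !mulr0 addr0.
- by rewrite weyl_coefZ // weyl_coef_monomial // eqxx mulr1.
rewrite weyl_coefZ // weyl_coef_monomial //.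
by have [->|_] := eqVneq x (0, 0)%N; rewrite ?lexx ?mulr0 ?eqxx.
Qed.

Lemma weyl_p_neq0 : weyl_p K != 0.
Proof.
by have := weyl_monomial_neq0 charK (1, 0)%N; rewrite /weyl_monomial mulr1. Qed.

Lemma weyl_q_neq0 : weyl_q K != 0.
Proof.
by have := weyl_monomial_neq0 charK (0, 1)%N; rewrite /weyl_monomial mul1r. Qed.

Lemma vdeg_over (rho sigma : R) : degree_over (@vdeg R K rho sigma).
Proof.
apply/seteqP; split=> [_ [c /= c0 <-]|_ ->]; first exact: vdeg_alg.
by exists 1; rewrite /= ?oner_neq0 // vdeg_alg ?oner_neq0.
Qed.

Lemma vdeg_evaluation_basis (rho sigma : R) :
  evaluation_basis (@vdeg R K rho sigma) y.
Proof.
split=> [|l _]; first exact: weyl_monomial_basis.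
rewrite vdegE // weyl_coef_lincomb //; congr ereal_sup.
by apply/seteqP; split=> _ [x lx <-]; exists x => //; rewrite vdeg_monomial.
Qed.

(** The values at p and q are finite and fix [u] on monomials by multiplicativity; the evaluation
    property then fixes it everywhere. *)
Lemma evaluation_basis_vdeg (u : weyl K -> \bar R) :
  degree_map u -> evaluation_basis u y ->
  exists rho sigma : R, 0 <= rho + sigma /\ u = vdeg rho sigma.
Proof.
move=> uP [_ u_eval].
have [rho up] := degree_finite uP weyl_p_neq0.
have [sigma uq] := degree_finite uP weyl_q_neq0.
have uy x : u (y x) = (weight rho sigma x)%:E.
  by rewrite (degreeM uP) (degreeX uP _ up) (degreeX uP _ uq).
exists rho, sigma; split.
  (* Here 0 = u(1) = u(qp - pq), which is at most the common value [rho + sigma] of u(qp) and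
     u(pq). *)
  rewrite -lee_fin -[0%:E]/0%E -(degree1 uP) -(weyl_rel K).
  apply: le_trans (degreeD uP _ _) _.
  by rewrite (degreeN uP) !(degreeM uP) up uq (addeC sigma%:E) maxxx -EFinD.
apply: funext => f; have [->|f0] := eqVneq f 0.
  by rewrite vdeg0 (iffRL (degree_eqNy uP 0)).
rewrite vdegE // -{1}(weyl_coefK f) u_eval ?weyl_coefK //.
congr ereal_sup; apply/seteqP.
by split=> _ [x fx <-]; exists x => //; rewrite uy.
Qed.

Lemma vdeg_scale (r rho sigma : R) (f : weyl K) : 0 < r -> f != 0 ->
  vdeg (r * rho) (r * sigma) f = (r%:E * vdeg rho sigma f)%E.
Proof.
have weightZ x : weight (r * rho) (r * sigma) x = r * weight rho sigma x.
  by rewrite /weight; ring.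
move=> r0 f0; have [a fa fE] := vdeg_neq0 charK rho sigma f0.
rewrite fE -EFinM -weightZ; apply: vdeg_max => // x fx.
rewrite !weightZ ler_pM2l // -lee_fin -fE.
exact: (iffLR (vdeg_le _ _ _ _ _) (lexx _)).
Qed.

(** Evaluating at p and q recovers the weights; conversely, a positive factor does not change which
    monomials attain the maximum. *)
Lemma vdeg_equivP (rho1 sigma1 rho2 sigma2 : R) :
  degree_equiv (@vdeg R K rho1 sigma1) (@vdeg R K rho2 sigma2) <->
  exists2 r : R, 0 < r & (rho2, sigma2) = (r * rho1, r * sigma1).
Proof.
split=> [[r r0 h]|[r r0 [-> ->]]]; exists r => //; last first.
  by move=> f; apply: vdeg_scale.
have := h _ weyl_p_neq0; have := h _ weyl_q_neq0.
by rewrite !vdeg_p // !vdeg_q // => -[->] [->].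
Qed.

Lemma vdeg_trivialP (rho sigma : R) :
  degree_map (@vdeg R K rho sigma) /\ degree_trivial (@vdeg R K rho sigma)
  <-> (rho, sigma) = (0, 0).
Proof.
split=> [[_ triv]|[-> ->]].
  have val0 f : f != 0 -> @vdeg R K rho sigma f = 0%E.
    by move=> f0; have : [set 0%E] (@vdeg R K rho sigma f);
      rewrite // -triv; exists f.
  have := val0 _ weyl_p_neq0; have := val0 _ weyl_q_neq0.
  by rewrite vdeg_p // vdeg_q // => -[->] [->].
split; first by apply: (vdeg_degree_map charK); rewrite addr0.
apply/seteqP; split=> [_ [f /= f0 <-]|_ ->].
  have [a _ ->] := vdeg_neq0 charK (0 : R) 0 f0.
  by rewrite /weight !mul0r addr0.
by exists 1%:A; rewrite ?vdeg_alg ?oner_neq0 //= scale1r oner_neq0.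
Qed.

(** The weights are the values at p and q, hence integer multiples [a] and [b] of [phi 1], and
    [b rho - a sigma = 0]. *)
Lemma discrete_Q_dependent (rho sigma : R) (D : unitRingType)
    (iota : {rmorphism weyl K -> D}) :
  (rho, sigma) <> (0, 0) -> degree_discrete iota (@vdeg R K rho sigma) ->
  Q_dependent rho sigma.
Proof.
move=> rs0 [u' [u'P u'E [phi [phi_inj phiE]]]].
have val (f : weyl K) (r : R) : vdeg rho sigma f = r%:E -> exists n, r = phi n.
  move=> fE; have : degree_values u' r%:E.
    exists (iota f); last by rewrite u'E.
    by apply/eqP => /(degree_eqNy u'P); rewrite u'E fE.
  by rewrite phiE => -[n _ [<-]]; exists n.
have [a rhoE] := val _ _ (vdeg_p charK rho sigma).
have [b sigmaE] := val _ _ (vdeg_q charK rho sigma).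
have phiZ n : phi n = phi 1 * n%:~R by rewrite mulrzr -raddfMz intz.
apply/Q_dependentP; exists b, (- a); split.
  case=> b0 /eqP; rewrite oppr_eq0 => /eqP a0.
  by apply: rs0; rewrite rhoE sigmaE a0 b0 raddf0.
by rewrite rhoE sigmaE (phiZ a) (phiZ b) rmorphN /=; ring.
Qed.

Lemma int_subn (a : int) : exists k l : nat, a = k%:Z - l%:Z.
Proof.
by case: a => k; [exists k, 0%N; rewrite subr0|exists 0%N, k.+1; rewrite sub0r].
Qed.

(** With [(rho, sigma) = c (m, n)] and [m], [n] coprime, the value group is exactly the set of
    integer multiples of [c]. *)
Lemma Q_dependent_discrete (rho sigma : R) (D : unitRingType)
    (iota : {rmorphism weyl K -> D}) :
  0 <= rho + sigma -> (rho, sigma) <> (0, 0) ->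
  quotient_division_ring iota -> Q_dependent rho sigma ->
  degree_discrete iota (@vdeg R K rho sigma).
Proof.
move=> rs rs0 DP dep; have uP := vdeg_degree_map charK rs.
have [m [n [c [cop _ c0 rhoE sigmaE]]]] := Q_dependent_coprime rs rs0 dep.
exists (qdr_degree (@vdeg R K rho sigma) iota).
split; [exact: qdr_degree_map|exact: qdr_degree_iota|].
have weightE x : weight rho sigma x = c *~ (m * x.1%:Z + n * x.2%:Z).
  by rewrite /weight rhoE sigmaE -[RHS]mulrzr rmorphD !rmorphM /=; ring.
exists ( *~%R c); split.
  by apply: mulrIz; rewrite gt_eqF.
rewrite qdr_degree_values //; apply/seteqP; split=> [e /=|_ [k _ <-] /=].
  move=> [z [w [z0 w0 ->]]].
  have [a _ ->] := vdeg_neq0 charK rho sigma z0.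
  have [b _ ->] := vdeg_neq0 charK rho sigma w0.
  exists (m * a.1%:Z + n * a.2%:Z - (m * b.1%:Z + n * b.2%:Z)) => //.
  by rewrite mulrzBr -!weightE.
(* By Bezout [k = m (x k) + n (z k)]. Monomial exponents are natural numbers, so [x k] and [z k] are
   split into differences and [k c] is the degree of a quotient of two monomials. *)
have [[x z] /= xz] := coprimezP _ _ cop.
have [i [i' ii]] := int_subn (x * k); have [j [j' jj]] := int_subn (z * k).
exists (y (i, j)), (y (i', j')).
rewrite !weyl_monomial_neq0 //; split=> //.
rewrite !vdeg_monomial // -EFinB !weightE -mulrzBr /=; congr ((c *~ _)%:E).
rewrite -[LHS]mul1r -[1]xz.
transitivity (m * (x * k) + n * (z * k)); first by ring.
by rewrite ii jj; ring.
Qed.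

Lemma Q_dependent_equiv (rho sigma : R) :
  0 <= rho + sigma -> (rho, sigma) <> (0, 0) -> Q_dependent rho sigma ->
  exists m n : int, [/\ coprimez m n, (0 <= m + n)%R &
    degree_equiv (@vdeg R K rho sigma) (@vdeg R K m%:~R n%:~R)].
Proof.
move=> rs rs0 /(Q_dependent_coprime rs rs0)[m [n [c [cop mn c0 -> ->]]]].
exists m, n; split=> //; apply/vdeg_equivP; exists c^-1.
  by rewrite invr_gt0.
by rewrite !mulKf // gt_eqF.
Qed.

End WeightedDegree.

Theorem proposition2p4 (R : realType) (K : fieldType)
    (charK : [pchar K] =i pred0) :
  (* (1) *)
  (forall u : weyl K -> \bar R,
     [/\ degree_map u, degree_over u & evaluation_basis u (@weyl_monomial K)]
     <-> exists rho sigma : R, 0 <= rho + sigma /\ u = vdeg rho sigma) /\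
  (* (2) *)
  (forall rho1 sigma1 rho2 sigma2 : R,
     0 <= rho1 + sigma1 -> 0 <= rho2 + sigma2 ->
     (degree_equiv (@vdeg R K rho1 sigma1) (@vdeg R K rho2 sigma2) <->
      exists2 r : R, 0 < r & (rho2, sigma2) = (r * rho1, r * sigma1))) /\
  (* (3) *)
  (forall rho sigma : R,
     degree_map (@vdeg R K rho sigma) /\ degree_trivial (@vdeg R K rho sigma)
     <-> (rho, sigma) = (0, 0)) /\
  (forall rho sigma : R, 0 <= rho + sigma -> (rho, sigma) <> (0, 0) ->
     (forall (D : unitRingType) (iota : {rmorphism weyl K -> D}),
        quotient_division_ring iota ->
        (degree_discrete iota (@vdeg R K rho sigma) <->
         Q_dependent rho sigma)) /\
     (Q_dependent rho sigma ->
        exists m n : int,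
          [/\ coprimez m n, (0 <= m + n)%R &
              degree_equiv (@vdeg R K rho sigma)
                           (@vdeg R K m%:~R n%:~R)])).
Proof.
split.
  move=> u; split=> [[uP _ /(evaluation_basis_vdeg charK uP)]//|].
  move=> [rho [sigma [rs ->]]]; split.
  - exact: vdeg_degree_map.
  - exact: vdeg_over.
  - exact: vdeg_evaluation_basis.
split; first by move=> *; apply: vdeg_equivP.
split; first exact: vdeg_trivialP.
move=> rho sigma rs rs0; split=> [D iota DP|]; last exact: Q_dependent_equiv.
split; first exact: discrete_Q_dependent.
exact: Q_dependent_discrete.
Qed.
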